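(* Let $(X,d)$ be a doubling metric space, let $(Y,d')$ be a metric space, and let $f:(X,d)\to(Y,d')$ be a quasi-Möbius homeomorphism. Then $(Y,d')$ is doubling.
   Context: A metric space is \emph{doubling} if there exists a constant $D>0$ such that every ball of finite radius can be covered by at most $D$ balls of half the radius. For a quadruple $Q=(x_1,x_2,x_3,x_4)$ of distinct points of a metric space $(X,d)$, the \emph{cross-ratio} is $$\mathrm{cr}(Q,d):=\frac{d(x_1,x_3)\,d(x_2,x_4)}{d(x_1,x_4)\,d(x_2,x_3)}.$$ A map $f:(X,d)\to(Y,d')$ is \emph{quasi-Möbius} if it is a homeomorphism and there exists a homeomorphism $\nu:[0,\infty)\to[0,\infty)$ such that for all quadruples $Q=(x_1,x_2,x_3,x_4)$ of distinct points of $X$, with $Q':=(f(x_1),f(x_2),f(x_3),f(x_4))$, one has $\mathrm{cr}(Q',d')\le\nu(\mathrm{cr}(Q,d))$. *)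

(* Defs.v *)
From mathcomp Require Import all_boot all_order all_algebra.
From mathcomp Require Import all_classical all_reals all_analysis.

Set Implicit Arguments.
Unset Strict Implicit.
Unset Printing Implicit Defensive.

Import Order.TTheory GRing.Theory Num.Theory.
Import numFieldNormedType.Exports.

Local Open Scope classical_set_scope.
Local Open Scope ring_scope.

(* [ball x r] is the open ball of radius [r] for the distance [mdist]. *)
Definition doubling (R : realType) (X : metricType R) : Prop :=
  exists2 D : nat, (0 < D)%N &
    forall (x : X) (r : R), 0 < r ->
      exists2 s : seq X, (size s <= D)%N &
        ball x r `<=` \bigcup_(y in [set` s]) ball y (r / 2).

Definition cross_ratio (R : realType) (X : metricType R) (x1 x2 x3 x4 : X) : R :=
  (mdist x1 x3 * mdist x2 x4) / (mdist x1 x4 * mdist x2 x3).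

Definition homeomorphism (T U : topologicalType) (f : T -> U) : Prop :=
  exists g : U -> T,
    [/\ cancel f g, cancel g f, continuous f & continuous g].

(* [f] restricts to a homeomorphism from [A] onto [B], both with the subspace
   topology; the values of [f] outside [A] are irrelevant. *)
Definition homeomorphism_on (T U : topologicalType) (A : set T) (B : set U)
    (f : T -> U) : Prop :=
  exists g : U -> T,
    [/\ set_fun A B f, set_fun B A g, {in A, cancel f g} & {in B, cancel g f}] /\
    {within A, continuous f} /\ {within B, continuous g}.

Definition quasi_moebius (R : realType) (X Y : metricType R) (f : X -> Y) : Prop :=
  homeomorphism f /\
  exists2 nu : R -> R,
    homeomorphism_on (`[0, +oo[ : set R) (`[0, +oo[ : set R) nu &
    forall x1 x2 x3 x4 : X, uniq [:: x1; x2; x3; x4] ->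
      cross_ratio (f x1) (f x2) (f x3) (f x4) <= nu (cross_ratio x1 x2 x3 x4).

(* Main.v *)
(* If a ball of radius r in Y is not covered by n balls of radius r/2, it
   contains n points with mutual distances in [r/2, 2r), so their cross-ratios
   are at least 1/16. Since nu is continuous with nu 0 = 0, the cross-ratios of
   the preimages are bounded below by some c > 0. It then suffices that in a
   doubling space X a finite set with cross-ratios at least c has bounded
   cardinality. Fix a in the set and let b be a farthest point from a, at
   distance M: every other point is at distance in [M/2, 2M] from a or from b,
   and on each of these two pieces the cross-ratios involving the centre of the
   annulus show that all mutual distances are comparable, so that iterating the
   doubling condition bounds the number of points. *)

Require Import Defs.
From mathcomp Require Import all_boot all_order all_algebra.
From mathcomp Require Import all_classical all_reals all_analysis.
From mathcomp Require Import ring lra.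

Import Order.TTheory GRing.Theory Num.Theory.
Import numFieldNormedType.Exports.

Local Open Scope classical_set_scope.
Local Open Scope ring_scope.

(** * Coverings and separated sets in metric spaces *)

Lemma leq_size_flatten_map (S T : Type) (t : S -> seq T) (m : nat) (s : seq S) :
  (forall x, size (t x) <= m)%N ->
  (size (flatten [seq t x | x <- s]) <= m * size s)%N.
Proof.
move=> tm; elim: s => [|x s IH] /=; first by rewrite muln0.
by rewrite size_cat mulnS leq_add.
Qed.

Lemma exists_max_in (R : realType) (T : eqType) (F : T -> R) (x : T) (s : seq T) :
  exists2 y, y \in x :: s & {in x :: s, forall z, F z <= F y}.
Proof.
elim: s x => [|x' s IH] x.
  by exists x => [|z]; rewrite ?inE// => /eqP ->.
have [y ys ymax] := IH x'; have [xy|yx] := leP (F x) (F y).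
  exists y => [|z]; first by rewrite inE ys orbT.
  by rewrite inE => /predU1P[->//|/ymax].
exists x => [|z]; first by rewrite mem_head.
by rewrite inE => /predU1P[->//|/ymax/le_trans]; apply; exact: ltW.
Qed.

Lemma covering_ball_pow2 (R : realType) (X : metricType R) (D : nat) :
  (forall (x : X) (r : R), 0 < r -> exists2 s : seq X, (size s <= D)%N &
    ball x r `<=` \bigcup_(y in [set` s]) ball y (r / 2)) ->
  forall (k : nat) (x : X) (r : R), 0 < r ->
    exists2 s : seq X, (size s <= D ^ k)%N &
      ball x r `<=` \bigcup_(y in [set` s]) ball y (r / 2 ^+ k).
Proof.
move=> hD; elim=> [|k IH] x r r0.
  exists [:: x] => // y xy; exists x => /=; first by rewrite mem_head.
  by rewrite expr0 divr1.
have [s sD xs] := IH x r r0.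
have rk0 : 0 < r / 2 ^+ k by rewrite divr_gt0// exprn_gt0.
have /choice[t ht] : forall y : X, exists t : seq X, (size t <= D)%N /\
    ball y (r / 2 ^+ k) `<=` \bigcup_(z in [set` t]) ball z (r / 2 ^+ k / 2).
  by move=> y; have [t tD yt] := hD y _ rk0; exists t.
exists (flatten [seq t y | y <- s]).
  rewrite (leq_trans (leq_size_flatten_map _ _ t D s _))//.
    by move=> y; have [] := ht y.
  by rewrite expnS leq_mul2l sD orbT.
move=> z /xs[y /= ys /(proj2 (ht y))[w /= wt wz]].
exists w => /=; first by apply/flatten_mapP; exists y.
by rewrite exprSr invfM mulrA.
Qed.

(** Pigeonhole: by the triangle inequality an open ball of radius [e] contains at most one point of
    [s], so assigning to each point a centre near it is injective. *)
Lemma separated_size_le (R : realType) (X : metricType R) (s t : seq X) (e : R) :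
  uniq s ->
  (forall p q, p \in s -> q \in s -> p != q -> 2 * e <= mdist p q) ->
  (forall p, p \in s -> exists2 y, y \in t & ball y e p) ->
  (size s <= size t)%N.
Proof.
move=> us sep cov.
have /choice[c hc] : forall p : X, exists y : X, p \in s -> y \in t /\ ball y e p.
  move=> p; have [ps|pNs] := boolP (p \in s); last by exists p.
  by have [y yt yp] := cov p ps; exists y.
rewrite -(size_map c s) uniq_leq_size//; last first.
  by move=> _ /mapP[p ps ->]; have [] := hc p ps.
rewrite map_inj_in_uniq// => p q ps qs cpq.
apply/eqP; apply: contraT => pq.
have [_] := hc p ps; have [_] := hc q qs; rewrite cpq !ballEmdist/= => cq cp.
have := sep p q ps qs pq; have := metric_triangle p (c q) q.
by rewrite (metric_sym p (c q)); lra.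
Qed.

(** Greedy choice: as long as the balls around the chosen points do not cover, an uncovered point is
    at distance at least [e] from all of them and can be added. *)
Lemma cover_or_separated (R : realType) (Y : metricType R) (x : Y) (r e : R) (n : nat) :
  0 < e ->
  (exists2 s : seq Y, (size s <= n)%N &
     ball x r `<=` \bigcup_(y in [set` s]) ball y e) \/
  exists s : seq Y, [/\ size s = n, uniq s, {in s, forall y, ball x r y} &
     {in s &, forall y z, y != z -> e <= mdist y z}].
Proof.
move=> e0; elim: n => [|n [[s sn xs]|[s [sn us sx sep]]]].
- by right; exists [::].
- by left; exists s => //; exact: leqW.
have [xs|] := pselect (ball x r `<=` \bigcup_(y in [set` s]) ball y e).
  by left; exists s => //; rewrite sn.
move=> /existsNP[y /not_implyP[xy ys]].
have far z : z \in s -> e <= mdist z y.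
  move=> zs; rewrite leNgt; apply/negP => zy.
  by apply: ys; exists z => //; rewrite ballEmdist.
right; exists (y :: s); split=> /=.
- by rewrite sn.
- rewrite us andbT; apply/negP => /far; by rewrite mdistxx leNgt e0.
- by move=> z; rewrite inE => /predU1P[->//|/sx].
- move=> z w; rewrite !inE => /predU1P[->|zs] /predU1P[->|ws] //.
  + by rewrite eqxx.
  + by rewrite metric_sym => _; exact: far.
  + by move=> _; exact: far.
  + exact: sep.
Qed.

(** * Homeomorphisms of the ray near 0 *)

(* A value [nu 0 > 0] would be attained a second time between the preimages
   of [0] and of [nu 0 + 1]. *)
Lemma homeomorphism_on_ray0 (R : realType) (nu : R -> R) :
  homeomorphism_on (`[0, +oo[ : set R) (`[0, +oo[ : set R) nu -> nu 0 = 0.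
Proof.
move=> [g [[nuP gP nuK gK] [cnu _]]].
have ge0P (t : R) : `[0, +oo[%classic t = (0 <= t) :> Prop.
  by rewrite /= in_itv/= andbT.
have nu0 : 0 <= nu 0 by rewrite -ge0P; apply: nuP; rewrite ge0P.
apply/eqP; rewrite eq_le nu0 andbT leNgt; apply/negP => v0.
have inj a : 0 <= a -> nu a = nu 0 -> a = 0.
  by move=> a0 /(congr1 g); rewrite !nuK// inE ge0P.
have gge0 (a : R) : 0 <= a -> 0 <= g a by rewrite -!ge0P; exact: gP.
have nug (a : R) : 0 <= a -> nu (g a) = a by rewrite -ge0P => ?; rewrite gK// inE.
have gne0 (a : R) : 0 <= a -> a != nu 0 -> 0 < g a.
  move=> a0 av; rewrite lt_neqAle gge0// andbT; apply: contra_neq av => ga.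
  by rewrite ga nug.
have p0 : 0 < g 0 by apply: gne0 => //; rewrite lt_eqF.
have q0 : 0 < g (nu 0 + 1) by apply: gne0; [lra | rewrite gt_eqF; lra].
have ivt a b : 0 < a -> a <= b -> Num.min (nu a) (nu b) <= nu 0 <= Num.max (nu a) (nu b) ->
    False.
  move=> a0 ab /IVT -/(_ ab)[].
    apply: continuous_subspaceW cnu => t /=; rewrite !in_itv/= andbT => /andP[+ _].
    by move=> /(le_trans (ltW a0)).
  move=> u; rewrite in_itv/= => /andP[au _] /inj.
  by have u0 := lt_le_trans a0 au; move/(_ (ltW u0)) => uE; rewrite uE ltxx in u0.
have [pq|/ltW qp] := leP (g 0) (g (nu 0 + 1)).
  by apply: (ivt _ _ p0 pq); rewrite !nug ?ge_min ?le_max; lra.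
by apply: (ivt _ _ q0 qp); rewrite !nug ?ge_min ?le_max; lra.
Qed.

(** Continuity at 0 together with [nu 0 = 0]. This turns a lower bound on cross-ratios of images
    into one on cross-ratios of preimages. *)
Lemma homeomorphism_on_ray_lt_near0 (R : realType) (nu : R -> R) (e : R) :
  homeomorphism_on (`[0, +oo[ : set R) (`[0, +oo[ : set R) nu -> 0 < e ->
  exists2 c : R, 0 < c & forall t, 0 <= t -> e <= nu t -> c <= t.
Proof.
move=> hnu e0; have nu0 := homeomorphism_on_ray0 _ _ hnu.
have [g [_ [/subspace_continuousP cnu _]]] := hnu.
have /cnu : `[0, +oo[%classic (0 : R) by rewrite /= in_itv/= lexx.
rewrite /from_subspace nu0 => /cvgrPdist_lt /(_ e e0); rewrite /within/= => /nbhs_ballP[c /= c0 hc].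
exists c => // t t0 et; rewrite leNgt; apply/negP => tc.
have := hc t; rewrite /ball/= sub0r normrN ger0_norm// in_itv/= t0 => /(_ tc isT).
by rewrite sub0r normrN ltNge (le_trans et)// ler_norm.
Qed.

(** * Sets with cross-ratios bounded below in a doubling space *)

Lemma cross_ratio_ge (R : realType) (X : metricType R) (c : R) (x1 x2 x3 x4 : X) :
  x1 != x4 -> x2 != x3 ->
  (c <= cross_ratio x1 x2 x3 x4) =
  (c * (mdist x1 x4 * mdist x2 x3) <= mdist x1 x3 * mdist x2 x4).
Proof. by move=> x14 x23; rewrite ler_pdivlMr// mulr_gt0 ?mdist_gt0. Qed.

Section MoebiusUniformSets.
Variables (R : realType) (X : metricType R) (c : R).

(** Exchanging [x3] and [x4] inverts the cross-ratio, so for positive [c] this also bounds it above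
    by [1 / c]. *)
Definition cross_ratios_ge (s : seq X) := forall x1 x2 x3 x4 : X,
  {subset [:: x1; x2; x3; x4] <= s} -> uniq [:: x1; x2; x3; x4] ->
  c <= cross_ratio x1 x2 x3 x4.

Lemma cross_ratios_geS (s t : seq X) :
  {subset s <= t} -> cross_ratios_ge t -> cross_ratios_ge s.
Proof. by move=> st ht x1 x2 x3 x4 xs; apply: ht => x /xs/st. Qed.

(* In the cross-ratio of [p, a, r, q] the distances to [a] are comparable and
   cancel up to the factor 4. *)
Lemma annulus_dist_le (a : X) (M : R) (s : seq X) : 0 < c -> 0 < M ->
  {in s, forall p, M / 2 <= mdist a p <= 2 * M} ->
  cross_ratios_ge (a :: s) ->
  forall p q r : X, {subset [:: p; q; r] <= s} -> uniq [:: p; q; r] ->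
  mdist p q <= (4 / c + 1) * mdist p r.
Proof.
move=> c0 M0 aM cs p q r sub u.
have [ps qs rs] : [/\ p \in s, q \in s & r \in s].
  by split; apply: sub; rewrite !inE eqxx ?orbT.
have aNs x : x \in s -> a != x.
  by move=> /aM /andP[h _]; rewrite -mdist_gt0; lra.
move: u; rewrite /= !inE !negb_or => /andP[/andP[pq pr] /andP[qr _]].
have := cs p a r q; rewrite cross_ratio_ge ?aNs// => /(_ _ _)-H.
have {}H : c * (mdist p q * mdist a r) <= mdist p r * mdist a q.
  apply: H => [x|/=].
    rewrite !inE => /or4P[] /eqP->; by rewrite ?eqxx ?ps ?rs ?qs ?orbT.
  by rewrite !inE !negb_or pq pr !aNs// (eq_sym p a) aNs//= eq_sym qr.
have /andP[ar _] := aM r rs; have /andP[_ aq] := aM q qs.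
have d1 := mdist_ge0 p q; have d2 := mdist_ge0 p r.
have h1 : c * (mdist p q * (M / 2)) <= mdist p r * (2 * M).
  apply: le_trans _ (le_trans H _); last exact: ler_wpM2l.
  by rewrite ler_pM2l//; exact: ler_wpM2l.
have h2 : c * mdist p q <= 4 * mdist p r.
  by rewrite -(ler_pM2r M0); move: h1; lra.
have h3 : mdist p q <= 4 / c * mdist p r.
  by rewrite mulrAC ler_pdivlMr// mulrC.
by rewrite mulrDl mul1r; lra.
Qed.

(** Two points [p], [r] of the set fix a scale [d]. The other points lie within [K * d] of [p] and
    are mutually at least [d / K ^+ 2] apart, where [K] depends only on [c]; the iterated doubling
    condition then bounds their number. *)
Lemma annulus_size_le : doubling X -> 0 < c -> exists N : nat,
  forall (a : X) (M : R) (s : seq X), 0 < M -> uniq s ->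
    {in s, forall p, M / 2 <= mdist a p <= 2 * M} ->
    cross_ratios_ge (a :: s) -> (size s <= N)%N.
Proof.
move=> [D _ /covering_ball_pow2 hD] c0.
set K := 4 / c + 1.
have K0 : 0 < K by rewrite addr_gt0// divr_gt0.
(* With this [k], twice the radius [2 * K * d / 2 ^+ k] stays below the separation [d / K ^+ 2]. *)
have [k hk] : exists k : nat, 4 * K ^+ 3 < 2 ^+ k.
  exists (Num.Def.archi_bound (4 * K ^+ 3)).
  exact: upper_nthrootP.
exists (D ^ k + 2)%N => a M s M0 us aM cs.
have := annulus_dist_le a M s c0 M0 aM cs; rewrite -/K; clearbody K => comp.
case: s us aM cs comp => [//|p [|r s]] us aM cs comp; first by rewrite addn2.
rewrite /= addn2 !ltnS.
have [pr ps rs us'] : [/\ p != r, p \notin s, r \notin s & uniq s].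
  by move: us; rewrite /= inE negb_or => /andP[/andP[-> ->] /andP[-> ->]].
set d := mdist p r; have d0 : 0 < d by rewrite mdist_gt0.
have neq x y : x \notin s -> y \in s -> x != y.
  by move=> xs ys; apply: contraNneq xs => ->.
have near q : q \in s -> mdist p q <= K * d /\ d <= K * mdist p q.
  move=> qs; split; apply: comp.
  - by move=> x; rewrite !inE => /or3P[] /eqP->; rewrite ?eqxx ?qs ?orbT.
  - by rewrite /= !inE !negb_or pr (neq p q)// (eq_sym q r) (neq r q).
  - by move=> x; rewrite !inE => /or3P[] /eqP->; rewrite ?eqxx ?qs ?orbT.
  - by rewrite /= !inE !negb_or pr (neq p q)// (neq r q).
(* Compare distances twice: from [p r] to [p q] at [p], then from [q p] to [q q'] at [q]. *)
have sep q q' : q \in s -> q' \in s -> q != q' -> d <= K ^+ 2 * mdist q q'.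
  move=> qs qs' qq'; have [_ h] := near q qs.
  apply: le_trans h _; rewrite expr2 -mulrA ler_pM2l// (metric_sym p).
  apply: comp.
    by move=> x; rewrite !inE => /or3P[] /eqP->; rewrite ?eqxx ?qs ?qs' ?orbT.
  by rewrite /= !inE !negb_or qq' (neq p q')// (eq_sym q p) (neq p q).
have [|t tD pt] := hD k p (2 * K * d); first by rewrite !mulr_gt0.
apply: leq_trans tD; apply: (@separated_size_le _ _ _ _ (2 * K * d / 2 ^+ k)) => //.
  move=> q q' qs qs' qq'.
  rewrite mulrA ler_pdivrMr ?exprn_gt0// -(ler_pM2l (exprn_gt0 2 K0)).
  rewrite [leRHS]mulrA; have := sep q q' qs qs' qq'.
  rewrite -(@ler_pM2r _ (2 ^+ k)) ?exprn_gt0//; apply: le_trans.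
  have K3 u : K ^+ 2 * (2 * (2 * K * u)) = u * (4 * K ^+ 3) by ring.
  by rewrite K3 ler_pM2l// ltW.
move=> q qs; have [h _] := near q qs.
have [|y /= yt yq] := pt q; last by exists y.
rewrite ballEmdist/=; apply: le_lt_trans h _.
by rewrite ltr_pM2r//; lra.
Qed.

(* Every point is far from [a] or from the point [b] farthest from [a], so the
   set splits into two annuli. *)
Lemma cross_ratios_ge_size_le : doubling X -> 0 < c ->
  exists N : nat, forall s : seq X, uniq s -> cross_ratios_ge s -> (size s <= N)%N.
Proof.
move=> hX c0; have [N hN] := annulus_size_le hX c0.
(* One [N] for each annulus, and 2 for the centres [a] and [b]. *)
exists (N + N + 2)%N; case=> [//|a [|x s]] us cs; first by rewrite addn2.
have [b bs bmax] := exists_max_in _ _ (mdist a) x s.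
have [as_ us'] : a \notin x :: s /\ uniq (x :: s).
  by move: us; rewrite [uniq (a :: _)]/= => /andP[].
set s1 := x :: s in cs bs bmax as_ us' *; set s2 := rem b s1.
have us2 : uniq s2 by rewrite rem_uniq.
have s21 : {subset s2 <= s1} by exact: mem_rem.
have bs2 : b \notin s2 by rewrite mem_rem_uniqF.
set M := mdist a b.
have M0 : 0 < M by rewrite mdist_gt0; apply: contraNneq as_ => ->.
rewrite [size _]/= (_ : size s = size s2); last by rewrite size_rem.
rewrite addn2 !ltnS -(count_predC (fun p => M / 2 <= mdist a p)) -!size_filter.
apply: leq_add.
- apply: (hN a M) => //; first exact: filter_uniq.
    move=> p; rewrite mem_filter => /andP[-> /s21/bmax] /=; rewrite -/M; lra.
  apply: cross_ratios_geS cs => y; rewrite in_cons mem_filter.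
  by case/predU1P => [->|/andP[_ /s21 ys]]; rewrite in_cons ?eqxx// ys orbT.
- apply: (hN b M) => //; first exact: filter_uniq.
    move=> p; rewrite mem_filter /= -ltNge => /andP[h /s21/bmax]; rewrite -/M => h'.
    (* A point closer than [M / 2] to [a] is at distance between [M / 2] and [3 * M / 2] from
       [b]. *)
    have := metric_triangle a p b; have := metric_triangle b a p.
    by rewrite -/M (metric_sym b a) -/M (metric_sym p b); lra.
  apply: cross_ratios_geS cs => y; rewrite in_cons mem_filter.
  by case/predU1P => [->|/andP[_ /s21 ys]]; rewrite in_cons ?bs ?ys orbT.
Qed.

End MoebiusUniformSets.

(** * Transfer to the target space *)

Lemma separated_cross_ratio_ge (R : realType) (Y : metricType R) (r : R) (s : seq Y) :
  0 < r -> {in s &, forall y z, mdist y z < 2 * r} ->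
  {in s &, forall y z, y != z -> r / 2 <= mdist y z} ->
  cross_ratios_ge R Y 16^-1 s.
Proof.
move=> r0 lt ge x1 x2 x3 x4 sub.
have [i1 i2 i3 i4] : [/\ x1 \in s, x2 \in s, x3 \in s & x4 \in s].
  by split; apply: sub; rewrite !inE eqxx ?orbT.
rewrite /= !inE !negb_or => /and4P[/and3P[n12 n13 n14] /andP[n23 n24] n34 _].
rewrite cross_ratio_ge//.
(* The numerator is at least [(r / 2) ^+ 2] and the denominator at most [(2 * r) ^+ 2], whence the
   factor 16. *)
apply: (@le_trans _ _ (16^-1 * ((2 * r) * (2 * r)))).
  by rewrite ler_wpM2l ?invr_ge0// ler_pM ?mdist_ge0// ltW// lt.
have -> : 16^-1 * ((2 * r) * (2 * r)) = r / 2 * (r / 2) by lra.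
by rewrite ler_pM ?ge// divr_ge0// ltW.
Qed.

Theorem theorem1 (R : realType) (X Y : metricType R) (f : X -> Y)
  (hX : doubling X) (hf : quasi_moebius f) : doubling Y.
Proof.
have [[g [fK gK _ _]] [nu hnu hcr]] := hf.
have [|c c0 hc] := homeomorphism_on_ray_lt_near0 R nu 16^-1 hnu; first by lra.
have [N hN] := cross_ratios_ge_size_le R X c hX c0.
(* If [N.+1] balls did not suffice, the preimages of [N.+1] separated points would violate the bound
   [N]. *)
exists N.+1 => // y r r0.
have r20 : 0 < r / 2 by rewrite divr_gt0.
have [//|[s [sN us sy sep]]] := cover_or_separated R Y y r (r / 2) N.+1 r20.
have lt : {in s &, forall z w, mdist z w < 2 * r}.
  move=> z w /sy + /sy; rewrite !ballEmdist/=.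
  have := metric_triangle z y w; rewrite (metric_sym z y); lra.
have := hN (map g s); rewrite size_map sN ltnn => H; have {H} : false => //.
apply: H; first by rewrite map_inj_uniq//; exact: can_inj gK.
move=> x1 x2 x3 x4 sub u; apply: hc.
  by rewrite divr_ge0 ?mulr_ge0 ?mdist_ge0.
apply: le_trans (hcr _ _ _ _ u).
apply: separated_cross_ratio_ge lt sep _ _ _ _ _ _ => //.
  by move=> _ /(@mapP _ _ f [:: x1; x2; x3; x4])[_ /sub/mapP[w ws ->] ->]; rewrite gK.
by rewrite -(map_inj_uniq (can_inj fK)) in u.
Qed.
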